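(* For every two integers $d,\ell \geq 2$, every graph $G$ with at least one vertex that is $\{S_d,K_{\ell,\ell}\}$-free has a vertex $v$ such that $\alpha(G[N[v]]) < d^2\ell + 2d\ell^{d-1}$.
   Context: Graphs are finite and simple. For $d\ge 2$, $S_d$ is the graph obtained from the star $K_{1,d}$ by subdividing each edge exactly once (so $S_2=P_5$). $K_{\ell,\ell}$ is the complete bipartite graph with parts of size $\ell$. A graph is $\mathcal{F}$-free if it has no induced subgraph isomorphic to a member of $\mathcal{F}$. $N[v]$ is the closed neighborhood of $v$ and $\alpha$ denotes the independence number. *)

(* Defs.v *)
From mathcomp Require Import all_boot.

Set Implicit Arguments.
Unset Strict Implicit.
Unset Printing Implicit Defensive.

Record sgraph := SGraph {
  svertex :> finType;
  adj : rel svertex;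
  adj_sym : symmetric adj;
  adj_irrefl : irreflexive adj }.

Definition isomorphic (G H : sgraph) : Prop :=
  exists2 f : G -> H, bijective f & forall x y : G, adj (f x) (f y) = adj x y.

Section Induced.
Variables (G : sgraph) (A : {set G}).

Definition induced_adj : rel {x : G | x \in A} :=
  [rel x y | adj (val x) (val y)].

Fact induced_adj_sym : symmetric induced_adj.
Proof. by move=> x y; exact: adj_sym. Qed.

Fact induced_adj_irrefl : irreflexive induced_adj.
Proof. by move=> x; exact: adj_irrefl. Qed.

Definition induced : sgraph := SGraph induced_adj_sym induced_adj_irrefl.
End Induced.

Definition family_free (F : sgraph -> Prop) (G : sgraph) : Prop :=
  forall H : sgraph, F H -> ~ exists A : {set G}, isomorphic (induced A) H.

Section CompleteBipartite.
Variables m n : nat.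

Definition biclique_adj : rel ('I_m + 'I_n)%type :=
  fun x y => match x, y with
             | inl _, inr _ | inr _, inl _ => true
             | _, _ => false
             end.

Fact biclique_adj_sym : symmetric biclique_adj.
Proof. by move=> [x|x] [y|y]. Qed.

Fact biclique_adj_irrefl : irreflexive biclique_adj.
Proof. by move=> [x|x]. Qed.

Definition biclique : sgraph := SGraph biclique_adj_sym biclique_adj_irrefl.
End CompleteBipartite.

(* The vertices of the 1-subdivision of G are the vertices and the edges of G
   (an edge being an unordered pair), adjacency being incidence. *)
Section Subdivision.
Variable G : sgraph.

Definition is_edge (e : {set G}) : bool :=
  [exists x, exists y, adj x y && (e == [set x; y])].

Definition subdiv_adj : rel (G + {e : {set G} | is_edge e})%type :=
  fun u v => match u, v with
             | inl x, inr e | inr e, inl x => x \in val e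
             | _, _ => false
             end.

Fact subdiv_adj_sym : symmetric subdiv_adj.
Proof. by move=> [x|x] [y|y]. Qed.

Fact subdiv_adj_irrefl : irreflexive subdiv_adj.
Proof. by move=> [x|x]. Qed.

Definition subdiv : sgraph := SGraph subdiv_adj_sym subdiv_adj_irrefl.
End Subdivision.

Definition subdivided_star (d : nat) : sgraph := subdiv (biclique 1 d).

Definition closed_nbhd (G : sgraph) (v : G) : {set G} :=
  [set u | (u == v) || adj v u].

Definition independent (G : sgraph) (A : {set G}) : bool :=
  [forall x in A, forall y in A, ~~ adj x y].

Definition alpha (G : sgraph) : nat :=
  \max_(A : {set G} | independent A) #|A|.

(* Main.v *)
(** Put D = l^(d-1) and choose v minimizing alpha(G[N[v]]) =: f; suppose f is at
    least the claimed bound. Let I be a maximum independent subset of N(v) and,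
    for each a in I, let J_a be an independent subset of N(a) of size at least f.
    Two independent sets X and Y, where some c is complete to X and anticomplete
    to Y, admit no induced matching of size d between them; together with
    K_{l,l}-freeness this leaves fewer than D vertices of X with D or more
    neighbors in Y. With c = a, X = J_a /\ N(v) and Y = I \ {a}, exchanging the
    other vertices of X for their neighbors in I shows that J_a meets N(v) in at
    most D + (d-1)(D-1) vertices, so Z_a = J_a \ N[v] is large. With c = v, X = I
    and Y = Z_a, each Z_a has fewer than D heavy neighbors in I, so some d vertices
    of I are pairwise light for each other; deleting from each of their sets Z_a
    the neighbors of the d-1 others and taking an independent transversal gives an
    induced S_d centered at v. *)

Require Import Defs.
From mathcomp Require Import all_boot.
From mathcomp Require Import zify.

Set Implicit Arguments.
Unset Strict Implicit.
Unset Printing Implicit Defensive.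

(** * Forbidden subgraphs as conditions on independent sets *)

Definition nbhd (G : sgraph) (x : G) : {set G} := [set y | adj x y].

(** Completeness of [A] to [B] forces disjointness, as [adj] is irreflexive. *)
Definition biclique_free (l : nat) (G : sgraph) : Prop :=
  forall A B : {set G}, independent A -> independent B ->
    {in A & B, forall a b, adj a b} -> l <= #|A| -> #|B| < l.

(** [c] is the centre, [A] the set of middle vertices and [y a] the leaf beyond [a]. The conditions
    force [y] to be injective on [A], with values outside [A]. *)
Definition spider_free (d : nat) (G : sgraph) : Prop :=
  forall (c : G) (A : {set G}) (y : G -> G), independent A ->
    {in A, forall a, [/\ adj c a, y a != c, ~~ adj c (y a) & adj a (y a)]} ->
    {in A &, forall a b, a != b -> ~~ adj a (y b) && ~~ adj (y a) (y b)} ->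
    #|A| < d.

(** For independent [A] and [Y] this is an induced matching between them that saturates [A]. *)
Definition private_nbrs (G : sgraph) (A Y : {set G}) : bool :=
  [forall a in A, exists y in Y,
     adj a y && [forall b in A, (b != a) ==> ~~ adj b y]].

Lemma independentP (G : sgraph) (A : {set G}) :
  reflect {in A &, forall x y, ~~ adj x y} (independent A).
Proof.
apply: (iffP forall_inP) => [h x y xA yA|h x xA].
  by have /forall_inP := h x xA; apply.
by apply/forall_inP => y yA; exact: h.
Qed.

Lemma sub_independent (G : sgraph) (A B : {set G}) :
  A \subset B -> independent B -> independent A.
Proof.
move=> /subsetP AB /independentP h; apply/independentP => x y /AB xB /AB.
exact: h.
Qed.

Lemma isomorphic_induced (G H : sgraph) (g : H -> G) :
  injective g -> (forall x y, adj (g x) (g y) = adj x y) ->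
  exists A : {set G}, isomorphic (induced A) H.
Proof.
move=> g_inj g_adj; pose A := [set g x | x in [set: H]].
have gA x : g x \in A by rewrite imset_f.
have pre (u : induced A) : exists x, g x == val u.
  by case/imsetP: (valP u) => x _ ->; exists x.
exists A; exists (fun u => xchoose (pre u)).
  exists (fun x => exist _ (g x) (gA x) : induced A) => [u|x].
    by apply: val_inj; apply/eqP; exact: (xchooseP (pre u)).
  by apply: g_inj; apply/eqP; exact: (xchooseP (pre (exist _ (g x) (gA x)))).
move=> u w; rewrite -g_adj.
by rewrite (eqP (xchooseP (pre u))) (eqP (xchooseP (pre w))).
Qed.

Lemma enum_injection (T : finType) (n : nat) (A : {set T}) :
  n <= #|A| -> exists2 h : 'I_n -> T, injective h & forall i, h i \in A.
Proof.
move=> nA; exists (fun i => enum_val (widen_ord nA i)) => [i j /enum_val_inj|i].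
  by move/(congr1 val) => /= ?; exact: val_inj.
exact: enum_valP.
Qed.

Lemma family_free_biclique (d l : nat) (G : sgraph) :
  family_free (fun H => H = subdivided_star d \/ H = biclique l l) G ->
  biclique_free l G.
Proof.
move=> hfree A B /independentP iA /independentP iB AB lA.
rewrite ltnNge; apply/negP => lB.
have [h h_inj hA] := enum_injection lA; have [k k_inj kB] := enum_injection lB.
apply: (hfree (biclique l l)); first by right.
pose g (u : biclique l l) : G :=
  match u with inl i => h i | inr j => k j end.
have hk i j : h i != k j.
  by apply/eqP => e; have := AB _ _ (hA i) (kB j); rewrite e adj_irrefl.
apply: (@isomorphic_induced _ _ g) => [[i|i] [j|j] /=|[i|i] [j|j] /=].
- by move/h_inj->.
- by move=> e; case/eqP: (hk i j).
- by move=> e; case/eqP: (hk j i).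
- by move/k_inj->.
- exact/negbTE/iA.
- exact: AB.
- by rewrite adj_sym AB.
- exact/negbTE/iB.
Qed.

Lemma family_free_spider (d l : nat) (G : sgraph) :
  family_free (fun H => H = subdivided_star d \/ H = biclique l l) G ->
  spider_free d G.
Proof.
move=> hfree c A y /independentP iA hc hy; rewrite ltnNge; apply/negP => dA.
have [h h_inj hA] := enum_injection dA.
apply: (hfree (subdivided_star d)); first by left.
(* An edge of the star is determined by its leaf, which therefore indexes the subdivision vertices;
   these go into [A], the leaves to values of [y]. *)
have leaf (e : {e : {set biclique 1 d} | is_edge e}) :
    exists i : 'I_d, val e == [set inl ord0; inr i].
  have /existsP[x /existsP[z /andP[]]] := valP e.
  case: x z => [x|x] [z|z] //= _ /eqP ->.
    by exists z; rewrite (ord1 x).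
  by exists x; rewrite (ord1 z) setUC.
pose lf e := xchoose (leaf e).
have lfE e : val e = [set inl ord0; inr (lf e)].
  exact/eqP/(xchooseP (leaf e)).
have memc (e : {e : {set biclique 1 d} | is_edge e}) x : (inl x \in val e) = true.
  by rewrite lfE !inE (ord1 x) eqxx.
have meml (e : {e : {set biclique 1 d} | is_edge e}) i : (inr i \in val e) = (i == lf e) by rewrite lfE !inE.
have lf_inj : injective lf.
  by move=> e1 e2 E; apply: val_inj; rewrite /= !lfE E.
pose g (u : subdivided_star d) : G :=
  match u with
  | inl (inl _) => c
  | inl (inr i) => y (h i)
  | inr e => h (lf e)
  end.
have hca i : adj c (h i) by have [] := hc _ (hA i).
have hyc i : y (h i) != c by have [] := hc _ (hA i).
have hcy i : adj c (y (h i)) = false by apply/negbTE; have [] := hc _ (hA i).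
have hay i j : adj (h i) (y (h j)) = (i == j).
  have [->|ij] := eqVneq i j; first by have [] := hc _ (hA j).
  by apply/negbTE; have /andP[] := hy _ _ (hA i) (hA j)
       (contra_neq (@h_inj _ _) ij).
have hyy i j : adj (y (h i)) (y (h j)) = false.
  have [->|ij] := eqVneq i j; first exact: adj_irrefl.
  by apply/negbTE; have /andP[] := hy _ _ (hA i) (hA j)
       (contra_neq (@h_inj _ _) ij).
have haa i j : adj (h i) (h j) = false by exact/negbTE/iA.
apply: (@isomorphic_induced _ _ g).
  move=> [[i|i]|e] [[j|j]|e'] /= E.
  - by rewrite (ord1 i) (ord1 j).
  - by case/eqP: (hyc j).
  - by have := hca (lf e'); rewrite -E adj_irrefl.
  - by case/eqP: (hyc i).
  - by have := hay i j; rewrite -E hay eqxx => /esym/eqP->.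
  - by have := hcy i; rewrite E hca.
  - by have := hca (lf e); rewrite E adj_irrefl.
  - by have := hcy j; rewrite -E hca.
  - by rewrite (lf_inj _ _ (h_inj _ _ E)).
move=> [[i|i]|e] [[j|j]|e'] /=.
- exact: adj_irrefl.
- exact: hcy.
- by rewrite hca memc.
- by rewrite adj_sym hcy.
- exact: hyy.
- by rewrite adj_sym hay meml eq_sym.
- by rewrite adj_sym hca memc.
- by rewrite hay meml eq_sym.
- exact: haa.
Qed.

(** * Common neighbors in K_{l,l}-free graphs *)

Lemma leq_card_bigcup (I : Type) (T : finType) (r : seq I) (P : pred I)
    (F : I -> {set T}) :
  #|\bigcup_(i <- r | P i) F i| <= \sum_(i <- r | P i) #|F i|.
Proof.
apply: (big_ind2 (fun (U : {set T}) n => #|U| <= n)) => [|U m W n mU nW|//].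
  by rewrite cards0.
by apply: leq_trans (leq_card_setU U W) _; exact: leq_add.
Qed.

(** If [l] vertices of [X] each missed at most p - 1 vertices of [P], at least lp - l(p-1) = l
    vertices of [P] would be adjacent to all of them, giving K_{l,l}. *)
Lemma card_mostly_covering (G : sgraph) (l p : nat) (X P : {set G}) :
  biclique_free l G -> independent X -> independent P -> l * p <= #|P| ->
  0 < l -> #|[set x in X | #|P :\: nbhd x| < p]| < l.
Proof.
move=> hK iX iP lpP l_gt0; set B := [set x in X | _].
rewrite ltnNge; apply/negP => lB.
have [h h_inj hB] := enum_injection lB.
pose A := [set h i | i in [set: 'I_l]].
have cA : #|A| = l by rewrite card_imset // cardsT card_ord.
have AB : A \subset B by apply/subsetP => _ /imsetP[i _ ->].
have AX : A \subset X.
  by apply: subset_trans AB _; apply/subsetP => x; rewrite inE => /andP[].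
pose Q := [set q in P | [forall a in A, adj a q]].
have : #|Q| < l.
  apply: (hK A Q); rewrite ?cA //; first exact: sub_independent iX.
    by apply: sub_independent iP; apply/subsetP => q; rewrite inE => /andP[].
  by move=> a q aA; rewrite inE => /andP[_ /forall_inP]; apply.
have PQ : P \subset Q :|: \bigcup_(a in A) (P :\: nbhd a).
  apply/subsetP => q qP; rewrite !inE qP /=.
  case: (boolP [forall a in A, adj a q]) => //= /forall_inPn[a aA naq].
  by apply/bigcupP; exists a; rewrite // !inE naq.
have le_sum : #|\bigcup_(a in A) (P :\: nbhd a)| <= l * p.-1.
  apply: leq_trans (leq_card_bigcup _ _ _) _.
  rewrite -cA -sum_nat_const; apply: leq_sum => a aA.
  by have := subsetP AB a aA; rewrite !inE => /andP[_]; case: p {lpP B lB hB AB}.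
have p_gt0 : 0 < p.
  have := hB (Ordinal l_gt0); rewrite inE => /andP[_].
  by apply: leq_trans.
have := leq_trans (subset_leq_card PQ) (leq_card_setU _ _).
case: p p_gt0 lpP le_sum {B lB hB AB} => //= p _; rewrite mulnS; lia.
Qed.

(** * Induced matchings *)

Lemma private_nbrsP (G : sgraph) (A Y : {set G}) :
  reflect {in A, forall a, exists y,
             [/\ y \in Y, adj a y & {in A, forall b, b != a -> ~~ adj b y}]}
          (private_nbrs A Y).
Proof.
apply: (iffP forall_inP) => h a aA.
  have /exists_inP[y yY /andP[ay /forall_inP hy]] := h a aA.
  by exists y; split=> // b bA; apply/implyP/hy.
have [y [yY ay hy]] := h a aA; apply/exists_inP; exists y => //.
by rewrite ay; apply/forall_inP => b bA; apply/implyP/hy.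
Qed.

(** As [c] is complete to [A] and anticomplete to [Y], it extends the induced matching to an induced
    subdivided star. *)
Lemma card_private_nbrs (d : nat) (G : sgraph) (c : G) (A Y : {set G}) :
  spider_free d G -> independent A -> independent Y -> A \subset nbhd c ->
  [disjoint Y & closed_nbhd c] -> private_nbrs A Y -> #|A| < d.
Proof.
move=> hS iA /independentP iY /subsetP Ac dYc /private_nbrsP hA.
have [y hy] : exists y : G -> G, forall a, a \in A ->
    [/\ y a \in Y, adj a (y a) & {in A, forall b, b != a -> ~~ adj b (y a)}].
  apply: (fin_all_exists (P := fun a y => a \in A -> [/\ y \in Y, adj a y &
    {in A, forall b, b != a -> ~~ adj b y}])) => a.
  by have [/hA[y hy]|] := boolP (a \in A); [exists y | exists a].
apply: (hS c A y) => // [a aA|a b aA bA ab].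
  have [yY ay _] := hy a aA; have := disjointFr dYc yY; rewrite inE.
  by move/negbT; rewrite negb_or => /andP[]; have := Ac a aA; rewrite inE.
have [yaY _ _] := hy a aA; have [ybY _ hb] := hy b bA.
by rewrite hb // iY.
Qed.

(** Both degrees into [W] count the common neighbors of [x] and [x']; subtract them. *)
Lemma card_set_residual (G : sgraph) (W : {set G}) (x x' : G) :
  #|W :&: nbhd x| <= #|W :&: nbhd x'| ->
  #|(W :&: nbhd x) :\: nbhd x'| <= #|(W :\: nbhd x) :&: nbhd x'|.
Proof.
have := cardsID (nbhd x') (W :&: nbhd x).
have := cardsID (nbhd x) (W :&: nbhd x').
have -> : (W :&: nbhd x') :&: nbhd x = (W :&: nbhd x) :&: nbhd x' by rewrite setIAC.
have -> : (W :&: nbhd x') :\: nbhd x = (W :\: nbhd x) :&: nbhd x'.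
  by rewrite setIDAC.
lia.
Qed.

(* Repeatedly picking a vertex x of minimum degree into W and deleting N(x) from W
   keeps the residual neighborhoods large, because |N(x') \ N(x)| >= |N(x) \ N(x')|.
   The sets in Ps are the neighborhoods of the vertices already picked, each of
   which must retain a private neighbor; they lose at most a factor l per step
   once at most l - 1 candidates per set are discarded. *)
Lemma exists_private_nbrs_protected (l n : nat) (G : sgraph)
    (Ps : seq {set G}) (X W : {set G}) :
  0 < l -> biclique_free l G -> independent X -> independent W ->
  {in Ps, forall P, independent P} ->
  {in Ps & X, forall P x, l ^ n <= #|P :\: nbhd x|} ->
  {in X, forall x, l ^ n <= #|W :&: nbhd x|} ->
  (l - 1) * \sum_((size Ps).+1 <= j < (size Ps).+1 + n) j < #|X| ->
  exists A : {set G}, [/\ A \subset X, #|A| = n.+1, private_nbrs A W &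
    {in Ps, forall P : {set G}, exists2 p, p \in P & {in A, forall a, ~~ adj a p}}].
Proof.
move=> l_gt0 hK; elim: n Ps X W => [|n IHn] Ps X W iX iW iPs hPs hX cX.
  have /card_gt0P[x xX] : 0 < #|X| by apply: leq_trans cX.
  exists [set x]; rewrite sub1set cards1; split=> //.
    apply/private_nbrsP => _ /set1P->.
    have /card_gt0P[y] := hX x xX; rewrite !inE => /andP[yW xy].
    by exists y; split=> // _ /set1P->; rewrite eqxx.
  move=> P PPs; have /card_gt0P[p] := hPs P x PPs xX.
  by rewrite !inE => /andP[xp pP]; exists p => // _ /set1P->.
have /card_gt0P[x0 x0X] : 0 < #|X| by apply: leq_trans cX.
case: (arg_minnP (fun x => #|W :&: nbhd x|) x0X) => x.
rewrite -/(x \in X) => xX xmin.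
(* [Q] reserves a private neighbor for [x]; the sets protected earlier lose N(x). *)
pose Q := W :&: nbhd x; pose Ps' := Q :: [seq P :\: nbhd x | P <- Ps].
pose bad (P : {set G}) := [set x' in X | #|P :\: nbhd x'| < l ^ n].
pose X' := X :\: \bigcup_(P <- Ps') bad P; pose W' := W :\: nbhd x.
have iQ : independent Q by apply: sub_independent iW; exact: subsetIl.
have iPs' : {in Ps', forall P, independent P}.
  move=> P; rewrite inE => /predU1P[->//|/mapP[P' P'Ps ->]].
  by apply: sub_independent (iPs P' P'Ps); exact: subsetDl.
have hPs' : {in Ps' & X', forall P x', l ^ n <= #|P :\: nbhd x'|}.
  move=> P x' PPs'; rewrite inE => /andP[x'B x'X]; rewrite leqNgt.
  apply: contra x'B => ltP; rewrite (big_rem P PPs') /= inE; apply/orP; left.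
  by rewrite inE x'X.
have sX' : X' \subset X by exact: subsetDl.
have cPs' : {in Ps', forall P : {set G}, l ^ n.+1 <= #|P|}.
  move=> P; rewrite inE => /predU1P[->|/mapP[P' P'Ps ->]]; first exact: hX.
  exact: hPs.
have [||x' x'X'||A [AX' cA pA hA]] := IHn Ps' X' W' _ _ iPs' hPs'.
- exact: sub_independent iX.
- by apply: sub_independent iW; exact: subsetDl.
- apply: leq_trans (hPs' Q x' (mem_head _ _) x'X') _.
  by apply: card_set_residual; apply: xmin; exact: (subsetP sX').
(* Each of the [(size Ps).+1] protected sets discards at most [l - 1] candidates, which is the first
   term of the assumed sum. *)
- have cB : #|\bigcup_(P <- Ps') bad P| <= (l - 1) * (size Ps).+1.
    apply: leq_trans (leq_card_bigcup _ _ _) _.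
    have -> : (l - 1) * (size Ps).+1 = \sum_(P <- Ps') (l - 1).
      by rewrite big_const_seq count_predT iter_addn_0 /= size_map mulnC.
    rewrite big_seq [leqRHS]big_seq; apply: leq_sum => P PPs'.
    have := card_mostly_covering (p := l ^ n) hK iX (iPs' P PPs').
    by rewrite -expnS => /(_ (cPs' P PPs') l_gt0); rewrite -/(bad P); lia.
  have cX' : #|X| <= #|X'| + #|\bigcup_(P <- Ps') bad P|.
    rewrite -(cardsID (\bigcup_(P <- Ps') bad P) X) addnC leq_add2l.
    exact/subset_leq_card/subsetIr.
  move: cX; rewrite big_ltn; last by lia.
  rewrite mulnDr /= size_map.
  have -> : (size Ps).+1 + n.+1 = (size Ps).+2 + n by lia.
  lia.
have QPs' : Q \in Ps' by exact: mem_head.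
(* [Q] has nothing left outside N(x), so [x] itself was discarded. *)
have xA : x \notin A.
  apply/negP => /(subsetP AX') xX'; have := hPs' Q x QPs' xX'.
  by rewrite /Q setDE -setIA setICr setI0 cards0 leqNgt expn_gt0 l_gt0.
exists (x |: A); split.
- by rewrite subUset sub1set xX (subset_trans AX').
- by rewrite cardsU1 xA cA.
(* The private neighbor of [x] comes from [Q]; those of [A] lie in [W'], which avoids N(x). *)
- apply/private_nbrsP => a; rewrite in_setU1 => /predU1P[->|aA].
    have [y] := hA Q QPs'; rewrite !inE => /andP[yW xy] hy.
    exists y; split=> // b; rewrite in_setU1 => /predU1P[->|bA _].
      by rewrite eqxx.
    exact: hy.
  have /private_nbrsP/(_ a aA)[y [yW' ay hy]] := pA.
  move: yW'; rewrite !inE => /andP[xy yW]; exists y; split=> // b.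
  by rewrite in_setU1 => /predU1P[->//|]; exact: hy.
move=> P PPs; have [|p] := hA (P :\: nbhd x).
    by rewrite in_cons (map_f (fun P => P :\: nbhd x) PPs) orbT.
rewrite !inE => /andP[xp pP] hp; exists p => // a.
by rewrite in_setU1 => /predU1P[->|]; last exact: hp.
Qed.

(** The left side is the discard budget when no set is protected at the start. Its increment
    (l-1)(n+1) is at most (l-1)l^n. *)
Lemma sum_ltn_expn (l n : nat) :
  1 < l -> (l - 1) * \sum_(1 <= j < 1 + n) j < l ^ n.
Proof.
move=> l_gt1; elim: n => [|n IHn]; first by rewrite big_geq ?muln0.
have n_lt := ltn_expl n l_gt1.
by move: IHn; rewrite !add1n (big_nat_recr n.+1) //= expnS; nia.
Qed.

(** Among l^d such vertices, d+1 would have private neighbors and form an S_{d+1} with centre [c].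
    Here [d] stands for the d - 1 of the theorem. *)
Lemma card_high_degree (d l : nat) (G : sgraph) (c : G) (X Y : {set G}) :
  1 < l -> biclique_free l G -> spider_free d.+1 G ->
  independent X -> independent Y -> X \subset nbhd c ->
  [disjoint Y & closed_nbhd c] ->
  #|[set x in X | l ^ d <= #|Y :&: nbhd x|]| < l ^ d.
Proof.
move=> l_gt1 hK hS iX iY Xc Yc; set H := [set x in X | _].
have HX : H \subset X by apply/subsetP => x; rewrite inE => /andP[].
have iH := sub_independent HX iX.
rewrite ltnNge; apply/negP => cH.
have [//|//|x||A [AH cA pA _]] :=
  @exists_private_nbrs_protected l d G [::] H Y (ltnW l_gt1) hK iH iY.
- by rewrite inE => /andP[].
- exact: leq_trans (sum_ltn_expn d l_gt1) cH.
have := card_private_nbrs hS (sub_independent AH iH) iY _ Yc pA.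
by rewrite cA ltnn => /(_ (subset_trans AH (subset_trans HX Xc))).
Qed.

(** * Domination, digraphs and independent transversals *)

(** In a smallest subset of [X] dominating these vertices every member has a private neighbor, so
    there are at most [d] members, each covering at most [m] vertices. *)
Lemma card_nbrs_le (d m : nat) (G : sgraph) (X Y : {set G}) :
  {in X, forall x, #|Y :&: nbhd x| <= m} ->
  (forall A : {set G}, A \subset X -> private_nbrs A Y -> #|A| <= d) ->
  #|[set y in Y | [exists x in X, adj x y]]| <= d * m.
Proof.
move=> hX hA; set S := [set y in Y | _].
pose dom (A : {set G}) :=
  (A \subset X) && [forall y in S, [exists a in A, adj a y]].
have domX : dom X.
  by rewrite /dom subxx; apply/forall_inP => y; rewrite inE => /andP[].
case: (arg_minnP (fun A : {set G} => #|A|) domX) => A /andP[AX /forall_inP AS] Amin.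
have : #|A| <= d.
  apply: hA => //; apply/private_nbrsP => a aA.
  (* A vertex that [A :\ a] fails to dominate is private to [a]. *)
  have : ~~ dom (A :\ a).
    by apply/negP => /Amin; rewrite (cardsD1 a A) aA; lia.
  rewrite /dom (subset_trans (subsetDl _ _) AX) /= => /forall_inPn[y yS].
  move=> /exists_inPn hy; exists y; split.
  - by move: yS; rewrite inE => /andP[].
  - have /exists_inP[b bA by_] := AS y yS; have [<-//|ba] := eqVneq b a.
    by have := hy b; rewrite !inE ba bA by_ => /(_ isT).
  by move=> b bA ba; apply: hy; rewrite !inE ba.
move=> cA; have SA : S \subset \bigcup_(a in A) (Y :&: nbhd a).
  apply/subsetP => y yS; have /exists_inP[a aA ay] := AS y yS.
  apply/bigcupP; exists a => //; rewrite !inE ay andbT.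
  by move: yS; rewrite inE => /andP[].
apply: leq_trans (subset_leq_card SA) _.
apply: leq_trans (leq_card_bigcup _ _ _) _.
apply: leq_trans (leq_mul cA (leqnn m)).
by rewrite -sum_nat_const; apply: leq_sum => a aA; apply: hX; exact: (subsetP AX).
Qed.

(* Some vertex of I has in-degree at most h, since the average does. *)
Lemma exists_independent_digraph (T : finType) (r : rel T) (h n : nat)
    (I : {set T}) :
  {in I, forall a, #|[set b in I | r a b]| <= h} -> n * (2 * h + 1) < #|I| ->
  exists A : {set T}, [/\ A \subset I, #|A| = n.+1 &
    {in A &, forall a b, a != b -> ~~ r a b}].
Proof.
elim: n I => [|n IHn] I hI cI.
  have /card_gt0P[a aI] : 0 < #|I| by apply: leq_trans cI.
  exists [set a]; rewrite sub1set cards1; split=> // x y /set1P-> /set1P->.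
  by rewrite eqxx.
have [a aI ha] : exists2 a, a \in I & #|[set b in I | r b a]| <= h.
  have [/exists_inP//|/exists_inPn hgt] :=
    boolP [exists a in I, #|[set b in I | r b a]| <= h].
  have swap : \sum_(a in I) #|[set b in I | r b a]| =
      \sum_(b in I) #|[set a in I | r b a]|.
    under eq_bigr do rewrite -sum1dep_card big_mkcondr.
    rewrite exchange_big /=; apply: eq_bigr => b _.
    by rewrite -sum1dep_card big_mkcondr.
  have : \sum_(a in I) h.+1 <= \sum_(a in I) h.
    apply: (@leq_trans (\sum_(a in I) #|[set b in I | r b a]|)).
      by apply: leq_sum => a aI; rewrite ltnNge hgt.
    by rewrite swap; apply: leq_sum => b; exact: hI.
  rewrite !sum_nat_const leq_pmul2l ?ltnn //.
  by apply: leq_trans cI.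
(* Removing [a] with its in- and out-neighbors costs at most 2h+1 vertices. *)
pose B := a |: ([set b in I | r b a] :|: [set b in I | r a b]).
have cB : #|B| <= 2 * h + 1.
  have := leq_trans (leq_card_setU [set a] _) (leq_add (leqnn _)
    (leq_card_setU [set b in I | r b a] [set b in I | r a b])).
  by rewrite -/B cards1; have := hI a aI; lia.
have [||A [AI cA hA]] := IHn (I :\: B).
- move=> b; rewrite inE => /andP[_ bI]; apply: leq_trans (hI b bI).
  apply/subset_leq_card/subsetP => c; rewrite !inE => /andP[/andP[_ ->]].
  by [].
- have := cardsID B I; have := subset_leq_card (subsetIr I B).
  by move: cI cB; rewrite mulSn; lia.
have aB : a \in B by rewrite setU11.
have hAB b : b \in A -> [/\ b \in I, b != a, ~~ r a b & ~~ r b a].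
  by move=> /(subsetP AI); rewrite !inE => /andP[+ bI]; rewrite bI /= !negb_or
     => /and3P[-> -> ->].
exists (a |: A); split.
- by rewrite subUset sub1set aI (subset_trans AI) ?subsetDl.
- rewrite cardsU1 cA; case: (boolP (a \in A)) => // /hAB[].
  by rewrite eqxx.
move=> x y; rewrite !in_setU1 => /predU1P[->|xA] /predU1P[->|yA].
- by rewrite eqxx.
- by have [] := hAB y yA.
- by have [] := hAB x xA.
exact: hA.
Qed.

Lemma ltn_predn_expn (l n : nat) : 0 < l -> n * (l - 1) < l ^ n.
Proof. by move=> l_gt0; elim: n => // n IHn; rewrite expnS; nia. Qed.

(** Greedy choice: each of the n+1 later sets excludes at most l - 1 vertices [x] of the current
    one, those leaving it fewer than l^n vertices outside N(x). Since (n+1)(l-1) < l^(n+1), some [x]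
    is left. *)
Lemma exists_independent_transversal (l n : nat) (G : sgraph) (J : eqType)
    (s : seq J) (Z : J -> {set G}) :
  0 < l -> biclique_free l G -> uniq s -> size s = n.+1 ->
  {in s, forall i, independent (Z i)} -> {in s, forall i, l ^ n <= #|Z i|} ->
  exists2 z : J -> G, {in s, forall i, z i \in Z i} &
    {in s &, forall i j, i != j -> ~~ adj (z i) (z j)}.
Proof.
move=> l_gt0 hK; elim: n s Z => [|n IHn] [//|i s] Z /= /andP[iNs us] [cs] iZ cZ.
  have {cs}-> := size0nil cs.
  have /card_gt0P[x xZ] := cZ i (mem_head _ _).
  exists (fun _ => x) => [j|j k]; rewrite !inE => /eqP-> //.
  by move=> /eqP->; rewrite eqxx.
have sS j : j \in s -> j \in i :: s by rewrite inE orbC => ->.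
pose bad j := [set x in Z i | #|Z j :\: nbhd x| < l ^ n].
have cB : #|\bigcup_(j <- s) bad j| <= n.+1 * (l - 1).
  apply: leq_trans (leq_card_bigcup _ _ _) _.
  have -> : n.+1 * (l - 1) = \sum_(j <- s) (l - 1).
    by rewrite big_const_seq count_predT iter_addn_0 cs mulnC.
  rewrite big_seq [leqRHS]big_seq; apply: leq_sum => j js.
  have := card_mostly_covering (p := l ^ n) hK (iZ i (mem_head _ _))
    (iZ j (sS j js)).
  rewrite -expnS => /(_ (cZ j (sS j js)) l_gt0); rewrite -/(bad j); lia.
have /card_gt0P[x] : 0 < #|Z i :\: \bigcup_(j <- s) bad j|.
  have := cardsID (\bigcup_(j <- s) bad j) (Z i).
  have := subset_leq_card (subsetIr (Z i) (\bigcup_(j <- s) bad j)).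
  have := cZ i (mem_head _ _); have := ltn_predn_expn n.+1 l_gt0; lia.
rewrite inE => /andP[xB xZ].
have [||z zZ hz] := IHn s (fun j => Z j :\: nbhd x) us cs.
- by move=> j js; apply: sub_independent (iZ j (sS j js)); exact: subsetDl.
- move=> j js; rewrite leqNgt; apply: contra xB => ltj.
  by rewrite (big_rem j js) /= inE inE xZ ltj.
exists (fun j => if j == i then x else z j) => [j|j k].
  rewrite inE; have [->|ji] /= := eqVneq j i; first by [].
  by move/zZ; rewrite inE => /andP[].
have xz m : m \in s -> ~~ adj x (z m) by move/zZ; rewrite !inE => /andP[].
rewrite !inE; have [->|ji] := eqVneq j i; have [->|ki] := eqVneq k i => //=.
- by move=> _ ks _; exact: xz.
- by move=> js _ _; rewrite adj_sym xz.
exact: hz.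
Qed.

(** * Maximum independent sets in neighborhoods *)

(** This is alpha(G[N[v]]) computed with subsets of [G] rather than of the subtype underlying
    [induced]. *)
Definition nbhd_alpha (G : sgraph) (v : G) : nat :=
  \max_(A : {set G} | independent A && (A \subset closed_nbhd v)) #|A|.

Lemma alpha_closed_nbhd_le (G : sgraph) (v : G) :
  alpha (induced (closed_nbhd v)) <= nbhd_alpha v.
Proof.
apply/bigmax_leqP => A /independentP iA.
rewrite -(card_imset (mem A) val_inj); apply: leq_bigmax_cond.
apply/andP; split; last by apply/subsetP => _ /imsetP[x _ ->]; exact: valP.
by apply/independentP => _ _ /imsetP[x xA ->] /imsetP[y yA ->]; exact: (iA x y).
Qed.

(** An independent subset of N[v] that contains [v] is just {v}. *)
Lemma exists_nbhd_alpha (G : sgraph) (v : G) : 1 < nbhd_alpha v ->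
  exists A : {set G}, [/\ independent A, A \subset nbhd v & #|A| = nbhd_alpha v].
Proof.
move=> gt1; have [|A /andP[iA Av] cA] := eq_bigmax_cond (fun A : {set G} => #|A|)
  (A := [pred A | independent A && (A \subset closed_nbhd v)]).
  apply/card_gt0P; exists set0; rewrite inE sub0set andbT.
  by apply/independentP => x y; rewrite inE.
rewrite -/(nbhd_alpha v) in cA; exists A; split=> //.
have vA : v \notin A.
  apply: contraL gt1 => vA; rewrite cA -leqNgt -(cards1 v).
  apply/subset_leq_card/subsetP => x xA; rewrite inE.
  have := subsetP Av x xA; rewrite inE => /orP[//|vx].
  by have := independentP _ iA v x vA xA; rewrite vx.
apply/subsetP => x xA; have := subsetP Av x xA; rewrite !inE => /predU1P[xv|//].
by rewrite -xv xA in vA.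
Qed.

(** Swapping [a] and [R] for [L] in [I] keeps an independent subset of N(v), so |L| <= |R| + 1 by
    maximality; add |H| <= l^d - 1. *)
Lemma card_nbhd_cap_maximum_independent (d l : nat) (G : sgraph) (v a : G)
    (I J : {set G}) :
  1 < l -> biclique_free l G -> spider_free d.+1 G ->
  independent I -> I \subset nbhd v -> #|I| = nbhd_alpha v -> a \in I ->
  independent J -> J \subset nbhd a ->
  #|J :&: nbhd v| <= l ^ d + d * (l ^ d - 1).
Proof.
move=> l_gt1 hK hS /[dup] iI /independentP hI Iv cI aI iJ Ja.
have D_gt0 : 0 < l ^ d by rewrite expn_gt0 ltnW.
pose X := J :&: nbhd v; pose Y := I :\ a.
have XJ : X \subset J by exact: subsetIl.
have Xa : X \subset nbhd a by exact: subset_trans XJ Ja.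
have iX : independent X := sub_independent XJ iJ.
have iY : independent Y by apply: sub_independent iI; exact: subsetDl.
have Ya : [disjoint Y & closed_nbhd a].
  rewrite disjoint_subset; apply/subsetP => y; rewrite !inE => /andP[ya yI].
  by rewrite negb_or ya hI.
pose H := [set x in X | l ^ d <= #|Y :&: nbhd x|]; pose L := X :\: H.
have cH : #|H| < l ^ d := card_high_degree l_gt1 hK hS iX iY Xa Ya.
have LX : L \subset X by exact: subsetDl.
have iL := sub_independent LX iX.
pose R := [set y in Y | [exists x in L, adj x y]].
(* Light degrees are at most l^d - 1, and induced matchings from [L] to [Y] have at most [d]
   edges. *)
have cR : #|R| <= d * (l ^ d - 1).
  apply: card_nbrs_le => [x|A AL pA].
    rewrite inE => /andP[xH xX]; rewrite leqNgt; apply: contra xH => lt_deg.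
    by rewrite inE xX; move: lt_deg; clear; lia.
  rewrite -ltnS; apply: card_private_nbrs hS (sub_independent AL iL) iY _ Ya pA.
  exact: subset_trans AL (subset_trans LX Xa).
have aL x : x \in L -> adj a x.
  by move=> /(subsetP LX) /(subsetP Xa); rewrite inE.
(* [a] is adjacent to all of [L] and to nothing in [I]. *)
have IL : [disjoint I :\: (a |: R) & L].
  rewrite disjoint_subset; apply/subsetP => y; rewrite inE => /andP[_ yI].
  by apply: contra (hI a y aI yI) => /aL.
have : #|(I :\: (a |: R)) :|: L| <= #|I|.
  rewrite cI; apply: leq_bigmax_cond; apply/andP; split.
    have hIL x y : x \in I :\: (a |: R) -> y \in L -> ~~ adj y x.
      move=> + yL; rewrite !inE negb_or => /andP[/andP[xa xR] xI].
      apply: contra xR => yx; rewrite xa xI; apply/exists_inP.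
      by exists y.
    apply/independentP => x y /setUP[] xI /setUP[] yI.
    - exact: (independentP _ (sub_independent (subsetDl _ _) iI)) xI yI.
    - by rewrite adj_sym hIL.
    - exact: hIL.
    - exact: (independentP _ iL) xI yI.
  apply/subsetP => x /setUP[].
    rewrite inE => /andP[_ /(subsetP Iv)]; rewrite !inE => ->.
    by rewrite orbT.
  by move=> /(subsetP LX); rewrite !inE => /andP[_ ->]; rewrite orbT.
have -> : #|(I :\: (a |: R)) :|: L| = #|I :\: (a |: R)| + #|L|.
  by apply/eqP; rewrite (leq_card_setU _ _).2.
have := cardsID (a |: R) I; have := subset_leq_card (subsetIr I (a |: R)).
have := cardsU1 a R; have := leq_b1 (a \notin R).
have := cardsID H X; have := subset_leq_card (subsetIr X H).
rewrite -/X -/L; move: cR cH; clear.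
move: (l ^ d) #|R| #|H| #|X| #|L| #|I| (d * _) => D r h x k i m.
move: #|_| #|_| #|_| #|_| (nat_of_bool _) => p q s t b; lia.
Qed.

(** * Construction of the induced subdivided star *)

Lemma spider_free_large_nbhds (d l : nat) (G : sgraph) (v : G) (I : {set G})
    (Z : G -> {set G}) :
  1 < l -> biclique_free l G -> spider_free d.+1 G ->
  independent I -> I \subset nbhd v -> d * (2 * (l ^ d - 1) + 1) < #|I| ->
  ~ {in I, forall a, [/\ independent (Z a), Z a \subset nbhd a,
       [disjoint Z a & closed_nbhd v] & l ^ d + d * (l ^ d - 1) <= #|Z a|]}.
Proof.
move=> l_gt1 hK hS iI Iv cI hZ.
have D_gt0 : 0 < l ^ d by rewrite expn_gt0 ltnW.
(* In the digraph used here, [a] points to the vertices of [I] that are heavy for [Z a]. *)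
have hH : {in I, forall a,
    #|[set b in I | l ^ d <= #|Z a :&: nbhd b|]| <= l ^ d - 1}.
  move=> a /hZ[iZ _ Zv _]; have := card_high_degree l_gt1 hK hS iI iZ Iv Zv.
  lia.
have [A [AI cA hA]] := exists_independent_digraph hH cI.
pose Z' a := Z a :\: \bigcup_(b in A :\ a) nbhd b.
have [|||a|z zZ hz] := @exists_independent_transversal l d G G (enum A) Z'
  (ltnW l_gt1) hK.
- exact: enum_uniq.
- by rewrite -cardE.
- move=> a; rewrite mem_enum => /(subsetP AI) /hZ[iZ _ _ _].
  by apply: sub_independent iZ; exact: subsetDl.
- rewrite mem_enum => aA; have [_ _ _ cZ] := hZ a (subsetP AI a aA).
  (* Each of the [d] other members of [A] is light for [Z a] and removes at most l^d - 1 vertices;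
     the l^d that remain are what a transversal of d+1 sets requires. *)
  have : #|Z a :&: \bigcup_(b in A :\ a) nbhd b| <= d * (l ^ d - 1).
    rewrite big_distrr /=; apply: leq_trans (leq_card_bigcup _ _ _) _.
    have cAa : #|A :\ a| = d by have := cardsD1 a A; rewrite aA cA; case.
    rewrite -{1}cAa -sum_nat_const; apply: leq_sum => b.
    rewrite !inE => /andP[ba bA].
    by have := hA a b aA bA; rewrite eq_sym ba => /(_ isT) /=; lia.
  by have := cardsID (\bigcup_(b in A :\ a) nbhd b) (Z a); rewrite -/(Z' a); lia.
have : #|A| < d.+1; last by rewrite cA ltnn.
have zP a : a \in A -> z a \in Z a /\ {in A, forall b, b != a -> ~~ adj b (z a)}.
  move=> aA; have := zZ a; rewrite mem_enum => /(_ aA).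
  rewrite inE => /andP[/bigcupP hb ->]; split=> // b bA ba.
  by apply/negP => bz; apply: hb; exists b; rewrite !inE ?ba.
apply: (hS v A z) => [|a aA|a b aA bA ab]; first exact: sub_independent iI.
  have aI := subsetP AI a aA; have [_ Za Zv _] := hZ a aI.
  have [zaZ _] := zP a aA.
  have := disjointFr Zv zaZ; rewrite inE => /negbT; rewrite negb_or => /andP[-> ->].
  by have := subsetP Iv a aI; have := subsetP Za _ zaZ; rewrite !inE => -> ->.
by have [_ ->] := zP b bA; rewrite // hz ?mem_enum.
Qed.

Theorem theorem1p8 (d l : nat) (hd : 2 <= d) (hl : 2 <= l) (G : sgraph)
    (hG : 0 < #|G|)
    (hfree : family_free (fun H => H = subdivided_star d \/ H = biclique l l) G) :
  exists v : G,
    alpha (induced (closed_nbhd v)) < d ^ 2 * l + 2 * d * l ^ (d - 1).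
Proof.
have hK := family_free_biclique hfree; have hS := family_free_spider hfree.
have /card_gt0P[v0 _] := hG.
case: (arg_minnP (@nbhd_alpha G) (isT : xpredT v0)) => v _ vmin; exists v.
apply: leq_ltn_trans (alpha_closed_nbhd_le v) _.
(* Writing d+1 for d matches the indexing of the lemmas above. *)
rewrite ltnNge; apply/negP; case: d hd hS {hfree} => // d hd hS.
rewrite subn1 /= => big.
have D_gt0 : 0 < l ^ d by rewrite expn_gt0 ltnW.
have gt1 (u : G) : 1 < nbhd_alpha u.
  apply: (leq_trans _ (vmin u isT)); apply: (leq_trans _ big).
  by rewrite -mulnn; nia.
have [J hJ] : exists J : G -> {set G}, forall u,
    [/\ independent (J u), J u \subset nbhd u & #|J u| = nbhd_alpha u].
  apply: (fin_all_exists (P := fun (u : G) (A : {set G}) =>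
    [/\ independent A, A \subset nbhd u & #|A| = nbhd_alpha u])) => u.
  exact: exists_nbhd_alpha.
have [iI Iv cI] := hJ v.
apply: (spider_free_large_nbhds (Z := fun a => J a :\: closed_nbhd v)
  hl hK hS iI Iv) => [|a aI].
  by rewrite cI; apply: (leq_trans _ big); rewrite -mulnn; nia.
have [iJ Ja cJ] := hJ a; split.
- by apply: sub_independent iJ; exact: subsetDl.
- by apply: subset_trans Ja; exact: subsetDl.
- by rewrite disjoint_sym disjoints_subset setCD subsetUr.
have cap := card_nbhd_cap_maximum_independent hl hK hS iI Iv cI aI iJ Ja.
(* [v] itself may lie in [J a]. *)
have : #|J a :&: closed_nbhd v| <= #|J a :&: nbhd v| + 1.
  rewrite -(cards1 v); apply: leq_trans (leq_card_setU _ _).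
  apply/subset_leq_card/subsetP => x; rewrite !inE => /andP[->].
  by rewrite orbC.
(* The term 2(d+1)l^d pays for l^d + d(l^d-1) twice, as the loss inside N(v) and as the size
   required outside N[v], and for the extra 1. *)
have := cardsID (closed_nbhd v) (J a); have := vmin a isT.
rewrite cJ -mulnn in big *; nia.
Qed.
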